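(* Let $X$ be a random set in $\mathfrak{X}$. If $\mathcal{L}^0(X,\mathcal{H})\neq\emptyset$, then $$\mathbf{M}(X-\gamma|\mathcal{H})=\big(\mathbf{m}((X-\gamma)^o|\mathcal{H})\big)^o\quad\text{a.s.}$$ for any $\gamma\in\mathcal{L}^0(X,\mathcal{H})$.
   Context: $\mathfrak{X}$ is a separable real Banach space with Borel $\sigma$-algebra $\mathcal{B}(\mathfrak{X})$; $(\Omega,\mathcal{F},\mathbf{P})$ is a complete probability space and $\mathcal{H}\subset\mathcal{F}$ is a sub-$\sigma$-algebra. $\mathfrak{X}^*$ is the dual space with pairing $\langle u,x\rangle$, equipped with the $\sigma(\mathfrak{X}^*,\mathfrak{X})$-topology and its Borel $\sigma$-algebra. An $\mathcal{H}$-measurable random set in $\mathfrak{X}$ (or in $\mathfrak{X}^*$) is a set-valued function on $\Omega$ whose graph belongs to the product of $\mathcal{H}$ and the Borel $\sigma$-algebra of the space; ''random set'' means $\mathcal{F}$-measurable; it is closed (convex) if its values are so for almost all $\omega$. $\mathcal{L}^0(X,\mathcal{H})$ is the family of $\mathcal{H}$-measurable random elements $\xi$ in $\mathfrak{X}$ with $\xi\in X$ a.s. The polar of a random set $X$ in $\mathfrak{X}$ is $X^o=\{u\in\mathfrak{X}^*:\ \langle u,x\rangle\leq1\ \text{for all } x\in X\}$, which is a random $\sigma(\mathfrak{X}^*,\mathfrak{X})$-closed convex set in $\mathfrak{X}^*$; the polar of a set $B\subset\mathfrak{X}^*$ is taken in $\mathfrak{X}$: $B^o=\{x\in\mathfrak{X}:\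 \langle u,x\rangle\leq1\ \text{for all } u\in B\}$. The conditional core $\mathbf{m}(Z|\mathcal{H})$ is the largest (with respect to a.s. inclusion) $\mathcal{H}$-measurable random set a.s. contained in $Z$ (here $Z$ is a random closed set in $\mathfrak{X}^*$). The conditional convex hull $\mathbf{M}(X|\mathcal{H})$ is the smallest (with respect to a.s. inclusion) $\mathcal{H}$-measurable random convex closed set which a.s. contains $X$. $X-\gamma=\{x-\gamma:\ x\in X\}$. *)

(* Defs.v *)
From HB Require Import structures.
From mathcomp Require Import all_boot all_order all_algebra.
From mathcomp Require Import all_classical all_reals all_analysis.

Set Implicit Arguments.
Unset Strict Implicit.
Unset Printing Implicit Defensive.

Import Order.TTheory GRing.Theory Num.Theory.
Import numFieldNormedType.Exports.

Local Open Scope classical_set_scope.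
Local Open Scope ring_scope.

Definition separable (T : topologicalType) : Prop :=
  exists2 D : set T, countable D & dense D.

Record dual (R : realType) (E : normedModType R) : Type := Dual {
  dual_fun :> {linear E -> R^o} ;
  dual_continuous : continuous dual_fun }.

Section dual_topology.
Variables (R : realType) (E : normedModType R).

Definition dual_eval (u : dual E) : {ptws E -> R^o} := fun x => u x.

Definition dual0 : dual E :=
  @Dual R E (\0 : {linear E -> R^o}) (fun x => @cst_continuous E R^o 0 x).

HB.instance Definition _ := gen_eqMixin (dual E).
HB.instance Definition _ := gen_choiceMixin (dual E).
HB.instance Definition _ := isPointed.Build (dual E) dual0.

(* The topology of [dual E] is sigma(E^*, E), not the norm topology: it is the
   initial topology for the embedding of E^* in the functions E -> R with
   pointwise convergence. *)
HB.instance Definition _ :=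
  Topological.copy (dual E) (initial_topology dual_eval).

End dual_topology.

Definition borel (T : ptopologicalType) := g_sigma_algebraType (@open T).

Section polar.
Variables (R : realType) (E : normedModType R).

Definition polar (A : set E) : set (dual E) :=
  [set u | forall x, A x -> u x <= 1].

Definition predual_polar (B : set (dual E)) : set E :=
  [set x | forall u, B u -> u x <= 1].

End polar.

Section random_sets.
Context (d : measure_display) (Omega : measurableType d) (R : realType).
Variables (P : probability Omega R) (H : set (set Omega)).

(* Here, as in the rest of the section, [H] is meant to be a sigma-algebra, so
   that the measurable sets of [g_sigma_algebraType H] are the members of [H].
   The values of a random set are allowed to be empty. *)
Definition random_set (T : ptopologicalType) (Y : Omega -> set T) : Prop :=
  measurable ([set p | Y p.1 p.2] : set (g_sigma_algebraType H * borel T)).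

Definition random_element (T : ptopologicalType) (xi : Omega -> T) : Prop :=
  measurable_fun setT (xi : g_sigma_algebraType H -> borel T).

Definition L0 (T : ptopologicalType) (Y : Omega -> set T) : set (Omega -> T) :=
  [set xi | random_element xi /\ {ae P, forall w, Y w (xi w)}].

Definition as_subset (T : Type) (Y Z : Omega -> set T) : Prop :=
  {ae P, forall w, Y w `<=` Z w}.

Definition is_cond_core (T : ptopologicalType) (Z C : Omega -> set T) : Prop :=
  [/\ random_set C, as_subset C Z &
      forall Y : Omega -> set T,
        random_set Y -> as_subset Y Z -> as_subset Y C].

Definition random_closed_convex (E : normedModType R) (Y : Omega -> set E) :
    Prop :=
  [/\ random_set Y, {ae P, forall w, closed (Y w)} &
      {ae P, forall w, convex_set (Y w)}].

Definition is_cond_convex_hull (E : normedModType R) (X M : Omega -> set E) :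
    Prop :=
  [/\ random_closed_convex M, as_subset X M &
      forall Y : Omega -> set E,
        random_closed_convex Y -> as_subset X Y -> as_subset M Y].

End random_sets.

Definition translate (Omega : Type) (E : zmodType) (X : Omega -> set E)
    (gamma : Omega -> E) : Omega -> set E :=
  fun w => [set x - gamma w | x in X w].

(* Main.v *)
Require Import Defs.
From HB Require Import structures.
From mathcomp Require Import all_boot all_order all_algebra.
From mathcomp Require Import all_classical all_reals all_analysis.
From mathcomp Require Import ring lra.
Import numFieldNormedType.Exports.
Import Order.TTheory GRing.Theory Num.Theory.

(** Why the statement holds. Write Y = X - gamma, so that 0 lies in Y almost
surely. Taking polars reverses inclusions, and by the bipolar theorem it is an
involution on closed convex sets containing 0. If it also preserved
measurability, it would exchange the closed convex measurable sets containing
Y with the measurable sets contained in the polar of Y, hence the smallest of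
the former with the largest of the latter. Concretely, let C be the core of
the polar of Y. The predual polar of C contains Y; and whenever a measurable
closed convex Y' contains Y, its polar is contained in C, so Y', which is its
own bipolar, contains the predual polar of C. This is
[cond_convex_hull_of_core]; since hull and core are unique up to null sets, it
is enough.

What remains is measurability and the existence of the core. Both rest on one
fact, the measurable projection theorem: the projection on Omega of a set in
the product of H and a Borel sigma-algebra differs by a null set from a member
of H ([suslin_projection]). The second factor is either the Banach space or
its dual with the weak-star topology. In both, every open set is a union of
members of one countable family of closed sets ([closed_network]), so that
measurable sets are Suslin sets; and a decreasing sequence of nonempty closed
sets that is small with respect to a sequence of countable covers has a common
point ([complete_covers]), by metric completeness in the first case and by
weak-star compactness of balls in the second.

By projection, the event that a random set meets a fixed measurable set belongs
to H up to a null set. With a dense sequence in the Banach space, the polar of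
a random set is described by countably many such events and closed conditions,
so it is again a random set ([random_polar], [random_predual_polar]). The core
is obtained by exhaustion ([cond_core_polar_exists]): for each of countably
many slabs of the dual, take the essentially largest event on which some
measurable random subset of the polar of Y meets the slab; the core consists
of the functionals that belong to a slab only on the corresponding event. *)

Set Implicit Arguments.
Unset Strict Implicit.
Unset Printing Implicit Defensive.

Local Open Scope classical_set_scope.
Local Open Scope ring_scope.

(** * Hahn-Banach theorem for sublinear functionals *)

Section hahn_banach.
Variables (R : realType) (V : lmodType R).
Implicit Types (p q : V -> R) (x y : V).

Definition sublinear p :=
  (forall x y, p (x + y) <= p x + p y) /\
  (forall t x, 0 <= t -> p (t *: x) = t * p x).

Lemma sublinearI p : (forall x y, p (x + y) <= p x + p y) -> p 0 = 0 ->
  (forall t x, 0 < t -> p (t *: x) <= t * p x) -> sublinear p.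
Proof.
move=> pD p0 pZ; split=> // t x; rewrite le_eqVlt => /predU1P[<-|t0].
  by rewrite scale0r mul0r.
apply/eqP; rewrite eq_le pZ//=.
have := pZ t^-1 (t *: x); rewrite invr_gt0 => /(_ t0).
by rewrite scalerA mulVf ?gt_eqF// scale1r -ler_pdivrMl ?invr_gt0// invrK.
Qed.

Lemma sublinear0 p : sublinear p -> p 0 = 0.
Proof. by case=> _ pZ; rewrite -(scale0r 0) pZ// mul0r. Qed.

Lemma sublinearN_ge p x : sublinear p -> - p (- x) <= p x.
Proof.
move=> sp; have [pD _] := sp.
by rewrite lerNl -subr_ge0 opprK addrC -(sublinear0 sp) -(subrr x) pD.
Qed.

Lemma le_inf_add (A B C : set R) : A !=set0 -> B !=set0 -> has_lbound C ->
  (forall a b, A a -> B b -> exists2 c, C c & c <= a + b) ->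
  inf C <= inf A + inf B.
Proof.
move=> A0 B0 lC ABC; rewrite -lerBlDr; apply: lb_le_inf => // a Aa.
rewrite lerBlDr -lerBlDl; apply: lb_le_inf => // b Bb.
by rewrite lerBlDl; have [c Cc] := ABC _ _ Aa Bb; apply: le_trans; exact: ge_inf.
Qed.

Lemma le_inf_scale (A C : set R) t : 0 < t -> A !=set0 -> has_lbound C ->
  (forall a, A a -> exists2 c, C c & c <= t * a) -> inf C <= t * inf A.
Proof.
move=> t0 A0 lC AC; rewrite -ler_pdivrMl//; apply: lb_le_inf => // a Aa.
rewrite ler_pdivrMl//; have [c Cc] := AC _ Aa.
by apply: le_trans; exact: ge_inf.
Qed.

(** The largest sublinear functional below [p] whose value at [- y] is at most
[- p y]; it takes the value [p y] at [y] and is linear on the line of [y]. *)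
Definition ray_inf p y x : R :=
  inf [set p (x + t *: y) - t * p y | t in [set t | 0 <= t]].

Lemma ray_inf_lbound p y x : sublinear p ->
  lbound [set p (x + t *: y) - t * p y | t in [set t | 0 <= t]] (- p (- x)).
Proof.
move=> [pD pZ] _ [t /= t0 <-]; rewrite lerBrDr addrC lerBlDr -pZ//.
by apply: le_trans (pD _ _); rewrite addrC addKr.
Qed.

Lemma ray_inf_le p y x t : sublinear p -> 0 <= t ->
  ray_inf p y x <= p (x + t *: y) - t * p y.
Proof.
move=> sp t0; apply: ge_inf; first by exists (- p (- x)); exact: ray_inf_lbound.
by exists t.
Qed.

Lemma ray_inf_sublinear p y : sublinear p -> sublinear (ray_inf p y).
Proof.
move=> sp; have [pD pZ] := sp.
have lb x : has_lbound [set p (x + t *: y) - t * p y | t in [set t | 0 <= t]].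
  by exists (- p (- x)); exact: ray_inf_lbound.
have n0 x : [set p (x + t *: y) - t * p y | t in [set t | 0 <= t]] !=set0.
  by exists (p (x + 0 *: y) - 0 * p y), 0 => /=.
apply: sublinearI => [x x'||s x s0].
- apply: le_inf_add => // _ _ [t /= t0 <-] [t' /= t'0 <-].
  exists (p (x + x' + (t + t') *: y) - (t + t') * p y).
    by exists (t + t') => //=; exact: addr_ge0.
  rewrite scalerDl addrACA [X in _ <= X]addrACA -opprD -mulrDl lerD2r.
  exact: pD.
- rewrite /ray_inf (_ : [set _ | _ in _] = [set 0]) ?inf1//.
  apply/seteqP; split=> [_ [t /= t0 <-]|_ ->]; first by rewrite add0r pZ// subrr.
  by exists 0 => //=; rewrite mul0r subr0 scale0r addr0 sublinear0.
- apply: le_inf_scale => // _ [t /= t0 <-].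
  exists (p (s *: x + (s * t) *: y) - (s * t) * p y).
    by exists (s * t) => //=; rewrite mulr_ge0// ltW.
  by rewrite -scalerA -scalerDr pZ ?(ltW s0)// -mulrA -mulrBr.
Qed.

(** [ray_inf q y] is sublinear and below [q], so minimality makes it equal to
[q]; the point [t = 1] of the infimum then gives [q x <= q (x + y) - q y]. *)
Lemma minimal_sublinear_additive q : sublinear q ->
  (forall r, sublinear r -> (forall x, r x <= q x) -> r = q) ->
  forall x y, q (x + y) = q x + q y.
Proof.
move=> sq qmin x y; apply/eqP; rewrite eq_le sq.1/=.
have qE : ray_inf q y = q.
  apply: qmin => [|z]; first exact: ray_inf_sublinear.
  rewrite -[leRHS]subr0 -(mul0r (q y)) -{2}(addr0 z) -(scale0r y).
  exact: ray_inf_le.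
have := @ray_inf_le q y x 1 sq ler01.
by rewrite qE scale1r mul1r lerBrDr.
Qed.

(** Zorn's lemma for the reversed pointwise order: the pointwise infimum of a
chain is finite, because every sublinear [q] below [p] satisfies
[- p (- x) <= q x], and it is subadditive because two members of a chain are
both dominated from below by one of them. *)
Lemma minimal_sublinear_exists p : sublinear p ->
  exists q, [/\ sublinear q, forall x, q x <= p x &
    forall r, sublinear r -> (forall x, r x <= q x) -> r = q].
Proof.
move=> sp; pose T := {q | sublinear q /\ forall x, q x <= p x}.
pose mk q (qs : sublinear q) (qp : forall x, q x <= p x) : T :=
  exist _ q (conj qs qp).
pose r (s t : T) := `[< forall x, sval t x <= sval s x >].
have [|s2 s1 s3 /asboolP s12 /asboolP s23||A tA|] := @Zorn T r.
- by move=> t; apply/asboolP.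
- by apply/asboolP => x; exact: le_trans (s12 x).
- move=> [s ps] [t pt] /asboolP/= st /asboolP/= ts; apply: eq_exist => /=.
  by apply/funext => x; apply/eqP; rewrite eq_le st ts.
  (* An empty chain has no infimum to take; [p] itself bounds it. *)
- have [[q0 Aq0]|A0] := pselect (A !=set0); last first.
    exists (mk p sp (fun=> lexx _)) => s As.
    by exfalso; apply: A0; exists s.
  pose D x := [set (sval q : V -> R) x | q in A].
  have lb x : has_lbound (D x).
    exists (- p (- x)) => _ [[q [sq qp]] /= _ <-].
    by apply: le_trans (sublinearN_ge x sq); rewrite lerN2.
  have n0 x : D x !=set0 by exists (sval q0 x), q0.
  have sm : sublinear (fun x => inf (D x)).
    apply: sublinearI => [x y||t x t0].
    + apply: le_inf_add => // _ _ [a Aa <-] [b Ab <-].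
      have [/asboolP ab|/asboolP ba] := tA _ _ Aa Ab.
        exists (sval b (x + y)); first by exists b.
        by apply: le_trans ((svalP b).1.1 _ _) _; rewrite lerD2r.
      exists (sval a (x + y)); first by exists a.
      by apply: le_trans ((svalP a).1.1 _ _) _; rewrite lerD2l.
    + rewrite (_ : D 0 = [set 0]) ?inf1//; apply/seteqP; split.
        by move=> _ [q _ <-]; rewrite /= sublinear0//; exact: (svalP q).1.
      by move=> _ ->; exists q0 => //; rewrite sublinear0//; exact: (svalP q0).1.
    + apply: le_inf_scale => // _ [a Aa <-].
      exists (sval a (t *: x)); first by exists a.
      by rewrite (svalP a).1.2// ltW.
  have mp x : inf (D x) <= p x.
    apply: le_trans ((svalP q0).2 x); apply: ge_inf => //; by exists q0.
  exists (mk _ sm mp) => s As; apply/asboolP => x /=.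
  by apply: ge_inf => //; exists s.
- move=> [q [sq qp]] qmax; exists q; split=> // s ss sq'.
  have sp' x : s x <= p x by exact: le_trans (sq' x) (qp x).
  suff /(congr1 sval) : mk s ss sp' = mk q sq qp by [].
  by apply: qmax; apply/asboolP.
Qed.

(** A minimal sublinear functional below [ray_inf p y] is linear; at [- y] it
is at most [- p y], so its value at [y] is at least, hence exactly, [p y]. *)
Lemma hahn_banach p y : sublinear p ->
  exists u : {linear V -> R^o}, (forall x, u x <= p x) /\ u y = p y.
Proof.
move=> sp; have [q [sq qp qmin]] :=
  minimal_sublinear_exists (ray_inf_sublinear y sp).
have qD := minimal_sublinear_additive sq qmin.
have qp' x : q x <= p x.
  apply: le_trans (qp x) _.
  rewrite -[leRHS]subr0 -(mul0r (p y)) -{2}(addr0 x) -(scale0r y).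
  exact: ray_inf_le.
have qN x : q (- x) = - q x.
  by apply/eqP; rewrite -subr_eq0 opprK -qD addNr sublinear0.
have qZ : linear_for *%R q.
  move=> t x z; rewrite qD; congr (_ + _).
  have [t0|t0] := leP 0 t; first exact: sq.2.
  rewrite -[t]opprK scaleNr qN sq.2 ?mulNr// oppr_ge0; exact: ltW.
pose L := GRing.isLinear.Build R V R^o *:%R q qZ.
pose u : {linear V -> R^o} := HB.pack q L.
exists u; split=> //; apply/eqP; rewrite eq_le qp'/=.
rewrite -lerN2 -qN; apply: le_trans (qp (- y)) _.
have := @ray_inf_le p y (- y) 1 sp ler01.
by rewrite scale1r addNr sublinear0// sub0r mul1r.
Qed.

End hahn_banach.

(** * Bipolar theorem *)

Section bipolar.
Variables (R : realType) (E : normedModType R).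
Implicit Types (M : set E) (x y : E).

Lemma convex_set_comb M x y (t : R) : convex_set M -> M x -> M y ->
  0 <= t -> t <= 1 -> M (t *: x + (1 - t) *: y).
Proof.
move=> cM Mx My t0 t1.
have := cM x y (Itv01 t0 t1); rewrite !inE => /(_ Mx My); exact.
Qed.

(** A finite and continuous substitute for the Minkowski gauge of [M]: the gauge
takes the least [t] such that [x] belongs to [t M], and here [x] is allowed to
miss [t M] at a cost of [c] times the distance. *)
Definition cone_gauge (c : R) M x : R :=
  inf [set t.1 + c * `|x - t.1 *: t.2| | t in [set t | 0 <= t.1 /\ M t.2]].

Lemma cone_gauge_le c M x t m : 0 <= c -> 0 <= t -> M m ->
  cone_gauge c M x <= t + c * `|x - t *: m|.
Proof.
move=> c0 t0 Mm; apply: ge_inf; last by exists (t, m).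
by exists 0 => _ [[s n] /= [s0 _] <-]; rewrite addr_ge0// mulr_ge0.
Qed.

(** Subadditivity is the convexity of [M]: the sum of a point of [t M] and a
point of [s M] lies in [(t + s) M]. *)
Lemma cone_gauge_sublinear c M : 0 <= c -> convex_set M -> M 0 ->
  sublinear (cone_gauge c M).
Proof.
move=> c0 cM M0.
have lb x : has_lbound
    [set t.1 + c * `|x - t.1 *: t.2| | t in [set t | 0 <= t.1 /\ M t.2]].
  by exists 0 => _ [[s n] /= [s0 _] <-]; rewrite addr_ge0// mulr_ge0.
have n0 x :
    [set t.1 + c * `|x - t.1 *: t.2| | t in [set t | 0 <= t.1 /\ M t.2]] !=set0.
  by exists (0 + c * `|x - 0 *: 0|), (0, 0).
apply: sublinearI => [x y||s x s0].
- apply: le_inf_add => // _ _ [[t m] /= [t0 Mm] <-] [[s n] /= [s0 Mn] <-].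
  have [k Mk kE] : exists2 k, M k & (t + s) *: k = t *: m + s *: n.
    have [ts0|ts0] := eqVneq (t + s) 0.
      exists 0 => //; rewrite scaler0.
      by move/eqP: ts0; rewrite paddr_eq0// => /andP[/eqP-> /eqP->];
        rewrite !scale0r addr0.
    have ts_gt0 : 0 < t + s by rewrite lt_neqAle eq_sym ts0 addr_ge0.
    exists ((t / (t + s)) *: m + (1 - t / (t + s)) *: n).
      apply: convex_set_comb => //; first by rewrite divr_ge0// ltW.
      by rewrite ler_pdivrMr// mul1r lerDl.
    rewrite scalerDr !scalerA mulrBr mulr1 mulrCA mulfV// mulr1.
    by rewrite [t + s]addrC addrK.
  exists ((t + s) + c * `|x + y - (t + s) *: k|).
    by exists (t + s, k) => //=; rewrite addr_ge0.
  rewrite kE [leRHS]addrACA lerD2l -mulrDr ler_wpM2l//.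
  by rewrite opprD addrACA ler_normD.
- apply/eqP; rewrite eq_le; apply/andP; split.
    apply: le_trans (cone_gauge_le _ c0 (lexx 0) M0) _.
    by rewrite add0r scale0r subrr normr0 mulr0.
  by apply: lb_le_inf => // _ [[s n] /= [s0 _] <-]; rewrite addr_ge0// mulr_ge0.
- apply: le_inf_scale => // _ [[t m] /= [t0 Mm] <-].
  exists (s * t + c * `|s *: x - (s * t) *: m|).
    by exists (s * t, m) => //=; rewrite mulr_ge0// ltW.
  by rewrite -scalerA -scalerBr normrZ gtr0_norm// mulrDr mulrCA.
Qed.

Lemma closed_dist_gt0 M x : closed M -> ~ M x ->
  exists2 r : R, 0 < r & forall m, M m -> r <= `|x - m|.
Proof.
move=> clM nMx; have : nbhs x (~` M).
  by apply: open_nbhs_nbhs; split=> //; exact: closed_openC.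
move=> /nbhs_ballP[r /= r0 rM]; exists r => // m Mm; rewrite leNgt.
by apply/negP => xm; apply: (rM m) => //; rewrite -ball_normE.
Qed.

(** If [r] is the distance from [x] to [M], then a term of the infimum with [t]
at most 1 costs at least [c r], as [t M] lies in [M]. For [t] slightly above 1
the distance to [t M] is still at least [r / 2], and for larger [t] the term
[t] alone exceeds 1 by a fixed amount. *)
Lemma cone_gauge_gt1 M x : closed M -> convex_set M -> M 0 -> ~ M x ->
  exists2 c : R, 0 <= c & 1 < cone_gauge c M x.
Proof.
move=> clM cM M0 /(closed_dist_gt0 clM)[r r0 rM].
exists (2 / r); first by rewrite divr_ge0// ltW.
set c := 2 / r; have cr : c * r = 2 by rewrite /c divfK// gt_eqF.
have c_ge0 : 0 <= c by rewrite divr_ge0// ltW.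
pose K := `|x|; have K0 : 0 <= K by exact: normr_ge0.
(* As long as [t <= 1 + d], the distance from [x] to [t M] is at least
   [r / 2], which costs [c r / 2 = 1 >= d]. *)
pose d := Num.min 1 (r / (2 * (K + 1))).
have d0 : 0 < d by rewrite lt_min ltr01 divr_gt0// mulr_gt0// ltr_wpDl.
have d1 : d <= 1 by rewrite ge_min lexx.
have dK : 2 * (d * K) <= r.
  have : d <= r / (2 * (K + 1)) by rewrite ge_min lexx orbT.
  rewrite ler_pdivlMr; last by rewrite mulr_gt0// ltr_wpDl.
  by nra.
have key t m : 0 <= t -> M m -> 1 + d <= t + c * `|x - t *: m|.
  move=> t0 Mm; have [t1|t1] := leP t 1.
    have : r <= `|x - t *: m|.
      apply: rM; have := convex_set_comb cM Mm M0 t0 t1.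
      by rewrite scaler0 addr0.
    by move=> /(ler_wpM2l c_ge0); rewrite cr => ?; lra.
  have xtm : t * r - (t - 1) * K <= `|x - t *: m|.
    have -> : x - t *: m = t *: (x - m) - (t - 1) *: x.
      by rewrite scalerBr scalerBl scale1r opprB [RHS]addrC subrKA.
    apply: le_trans (lerB_dist _ _); rewrite !normrZ.
    rewrite (ger0_norm t0) (@ger0_norm _ (t - 1)) ?subr_ge0 ?(ltW t1)//.
    by rewrite lerD2r ler_wpM2l// rM.
  have [td|td] := leP (1 + d) t.
    by rewrite (le_trans td)// lerDl mulr_ge0.
  have hr : r / 2 <= `|x - t *: m|.
    by apply: le_trans xtm; nra.
  have := ler_wpM2l c_ge0 hr; rewrite mulrA cr.
  by lra.
apply: (@lt_le_trans _ _ (1 + d)); first by rewrite ltrDl.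
apply: lb_le_inf => [|_ [[t m] /= [t0 Mm] <-]]; last exact: key.
by exists (0 + c * `|x - 0 *: 0|), (0, 0).
Qed.

(** A point [x] outside [M] has gauge above 1 while the points of [M] have gauge
at most 1, so the Hahn-Banach functional for the gauge at [x] separates; it is
continuous because the gauge is at most [c] times the norm. *)
Lemma bipolar M : closed M -> convex_set M -> M 0 ->
  predual_polar (polar M) = M.
Proof.
move=> clM cM M0; apply/seteqP; split=> [x xM|x Mx u]; last exact.
apply: contrapT => nMx; have [c c0 gx] := cone_gauge_gt1 clM cM M0 nMx.
have [u [uM ux]] := hahn_banach x (cone_gauge_sublinear c0 cM M0).
have uc y : `|u y| <= c * `|y|.
  have uc' z : u z <= c * `|z|.
    apply: le_trans (uM _) _; apply: le_trans (cone_gauge_le _ c0 (lexx 0) M0) _.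
    by rewrite add0r scale0r subr0.
  by rewrite ler_norml uc' lerNl -linearN -[`|y|]normrN uc'.
have cu : continuous u.
  apply/linear_bounded_continuous/linear_boundedP.
  exists c; split=> [|r /ltW cr y]; first exact: num_real.
  by apply: le_trans (uc y) _; rewrite ler_wpM2r.
suff : polar M (Dual cu) by move/xM => /=; rewrite ux leNgt gx.
move=> m Mm /=; apply: le_trans (uM _) _.
apply: le_trans (cone_gauge_le _ c0 ler01 Mm) _.
by rewrite scale1r subrr normr0 mulr0 addr0.
Qed.

End bipolar.

(** * Null sets and exhaustion *)

Lemma natSinv_lt (R : realType) (e : R) : 0 < e -> exists n, n.+1%:R^-1 < e.
Proof.
move=> e0; have [n _ /(_ n) /= ne] := near_infty_natSinv_lt (PosNum e0).
by exists n; exact: ne.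
Qed.

Section exhaustion.
Context d (Omega : measurableType d) (R : realType) (P : probability Omega R).

Lemma ae_forall_countable (I : countType) (Q : I -> Omega -> Prop) :
  (forall i, {ae P, forall w, Q i w}) -> {ae P, forall w, forall i, Q i w}.
Proof.
move=> aeQ; pose Q' n w := if unpickle n is Some i then Q i w else True.
have : {ae P, forall w, forall n, Q' n w}.
  apply: ae_foralln => n; rewrite /Q'.
  by case: (unpickle n) => [i|]; [exact: aeQ|exact: aeW].
by apply: filterS => w Qw i; have := Qw (pickle i); rewrite /Q' pickleK.
Qed.

(** The essential supremum of a family of events, attained in the family: a
countable union of members whose probabilities approach the supremum. *)
Lemma exhaustion (AA : set (set Omega)) : AA `<=` measurable -> AA !=set0 ->
  (forall A : (set Omega)^nat, (forall n, AA (A n)) -> AA (\bigcup_n A n)) ->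
  exists2 A, AA A & forall B, AA B -> P.-negligible (B `\` A).
Proof.
move=> mAA [A0 AA0] AAU.
pose V := [set fine (P A) | A in AA].
have finP A : AA A -> P A \is a fin_num.
  by move=> /mAA mA; exact: fin_num_measure.
have V1 : ubound V 1.
  move=> _ [A AA_A <-]; rewrite -lee_fin fineK ?finP//.
  by apply: probability_le1; exact: mAA.
have supV : has_sup V by split; [exists (fine (P A0)), A0|exists 1].
have sVn n : exists A, AA A /\ sup V - n.+1%:R^-1 < fine (P A).
  have [|_ [A AA_A <-] ?] := @sup_adherent _ _ n.+1%:R^-1 _ supV.
    by rewrite invr_gt0.
  by exists A.
have [A AP] := choice sVn.
have AA_U := AAU A (fun n => (AP n).1).
exists (\bigcup_n A n) => // B AA_B.
have mU := mAA _ AA_U; have mB := mAA _ AA_B.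
exists (B `\` \bigcup_n A n); split=> //; first exact: measurableD.
have UB : AA ((\bigcup_n A n) `|` B).
  pose C n := if n is 0%N then \bigcup_n A n else B.
  rewrite (_ : _ `|` _ = \bigcup_n C n); first by apply: AAU; case.
  apply/seteqP; split=> [w [Aw|Bw]|w [[|n] _]].
  - by exists 0%N.
  - by exists 1%N.
  - by left.
  - by right.
have le_sup : fine (P ((\bigcup_n A n) `|` B)) <= sup V.
  by apply: ub_le_sup; [exact: supV.2|exists ((\bigcup_n A n) `|` B)].
have ge_sup : sup V <= fine (P (\bigcup_n A n)).
  apply/ler_addgt0Pr => e e0.
  have [n ne] := natSinv_lt e0.
  rewrite -lerBlDr; apply: (@le_trans _ _ (sup V - n.+1%:R^-1)).
    by rewrite lerB// ltW.
  apply: le_trans (ltW (AP n).2) _; rewrite fine_le ?finP//.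
    by have [] := AP n.
  apply: le_measure; rewrite ?inE//; last exact: bigcup_sup.
  by apply: mAA; have [] := AP n.
have mBU : measurable (B `\` \bigcup_n A n) by exact: measurableD.
have PUB : P ((\bigcup_n A n) `|` B) =
    (P (\bigcup_n A n) + P (B `\` \bigcup_n A n))%E.
  rewrite -measureU//; first by congr (P _); rewrite setDE setUIr setUv setIT.
  by rewrite setDE setICA setICr setI0.
have := le_trans le_sup ge_sup; rewrite PUB -lee_fin !fineK ?finP//; last first.
  by rewrite -PUB finP.
rewrite -[leRHS]adde0 leeD2lE ?finP// => PBU.
by apply/eqP; rewrite eq_le PBU measure_ge0.
Qed.

End exhaustion.

(** * Suslin sets in a product *)

Section suslin.
Variables (Omega : Type) (T : topologicalType) (H : set (set Omega)).
Implicit Types (C : set (nat -> nat)) (G : set (Omega * T)).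

(** Closedness in the product topology of the Baire space: [s] belongs to [C]
as soon as every finite initial segment of [s] extends to an element of [C]. *)
Definition tree_closed C := forall s : nat -> nat,
  (forall N, exists2 r, C r & forall n, (n < N)%N -> r n = s n) -> C s.

(** The [n]-th rectangle depends on the [n]-th entry of [s] only, instead of on
the initial segment of length [n] as in the classical Suslin operation; the
dependence between levels is carried by the closed set [C]. Each of the two
forms reduces to the other by coding initial segments as numbers, and in this
one a countable intersection is a mere interleaving of branches. *)
Definition scheme_set C (K : nat -> nat -> set Omega * set T) :=
  [set p : Omega * T | exists2 s, C s &
    forall n, (K n (s n)).1 p.1 /\ (K n (s n)).2 p.2].

Definition suslin G := exists CK :
    set (nat -> nat) * (nat -> nat -> set Omega * set T),
  [/\ tree_closed CK.1, forall n k, H (CK.2 n k).1,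
      forall n k, closed (CK.2 n k).2 & G = scheme_set CK.1 CK.2].

Let unpair (k : nat) : nat * nat := odflt (0, 0)%N (unpickle k).

Let unpairK p : unpair (pickle p) = p.
Proof. by rewrite /unpair pickleK. Qed.

Lemma suslin_rect A F : H A -> closed F -> suslin (A `*` F).
Proof.
move=> HA clF; exists (setT, fun _ _ => (A, F)); split=> //=.
apply/seteqP; split=> [p [Ap Fp]|p [s _ /(_ 0%N)//]].
by exists (fun=> 0%N).
Qed.

(** Every entry of [s] carries the index [i] along with an entry of a branch of
the [i]-th scheme, and the closed set forces all the indices to agree. *)
Lemma suslin_bigcup (G : (set (Omega * T))^nat) :
  (forall i, suslin (G i)) -> suslin (\bigcup_i G i).
Proof.
move=> /choice[CK CKP].
exists ([set s | (forall n, (unpair (s n)).1 = (unpair (s 0%N)).1) /\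
               (CK (unpair (s 0%N)).1).1 (fun n => (unpair (s n)).2)],
        fun n k => (CK (unpair k).1).2 n (unpair k).2); split=> /=.
- move=> s sC; have s0 n : (unpair (s n)).1 = (unpair (s 0%N)).1.
    by have [r [rE _] rs] := sC n.+1; rewrite -!rs.
  split=> //; have [+ _ _ _] := CKP (unpair (s 0%N)).1; apply=> N.
  have [r [rE rC] rs] := sC N.+1.
  exists (fun n => (unpair (r n)).2); first by rewrite -rs.
  by move=> n nN; rewrite rs// ltnS ltnW.
- by move=> n k; have [] := CKP (unpair k).1.
- by move=> n k; have [] := CKP (unpair k).1.
- apply/seteqP; split=> p.
    move=> [i _ Gip]; have [_ _ _ GE] := CKP i.
    move: Gip; rewrite GE => -[s sC sp].
    exists (fun n => pickle (i, s n)); last by move=> n; rewrite unpairK.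
    by split=> [n|]; rewrite ?unpairK//; under eq_fun do rewrite unpairK.
  move=> [s [sE sC] sp]; exists (unpair (s 0%N)).1 => //.
  have [_ _ _ ->] := CKP (unpair (s 0%N)).1.
  by exists (fun n => (unpair (s n)).2) => // n; rewrite -(sE n).
Qed.

(** A point of the intersection has a branch in each scheme; a pairing function
interleaves these countably many branches into a single one. *)
Lemma suslin_bigcap (G : (set (Omega * T))^nat) :
  (forall i, suslin (G i)) -> suslin (\bigcap_i G i).
Proof.
move=> /choice[CK CKP].
exists ([set s | forall i, (CK i).1 (fun n => s (pickle (i, n)))],
        fun j k => (CK (unpair j).1).2 (unpair j).2 k); split=> /=.
- move=> s sC i; have [+ _ _ _] := CKP i; apply=> N.
  (* A length exceeding every code [pickle (i, n)] with [n < N]. *)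
  have [r rC rs] := sC (\sum_(n < N) (pickle (i, n : nat)).+1)%N.
  exists (fun n => r (pickle (i, n))) => // n nN; apply: rs.
  by rewrite (bigD1 (Ordinal nN))//= addSn ltnS leq_addr.
- by move=> n k; have [] := CKP (unpair n).1.
- by move=> n k; have [] := CKP (unpair n).1.
- apply/seteqP; split=> p.
    move=> Gp; have /choice[s sP] : forall i, exists s : nat -> nat,
        (CK i).1 s /\
        forall n, ((CK i).2 n (s n)).1 p.1 /\ ((CK i).2 n (s n)).2 p.2.
      move=> i; have [_ _ _ GE] := CKP i.
      by have := Gp i I; rewrite GE => -[s]; exists s.
    exists (fun j => s (unpair j).1 (unpair j).2) => [i|j]; last exact: (sP _).2.
    by under eq_fun do rewrite unpairK; exact: (sP i).1.
  move=> [s sC sp] i _; have [_ _ _ ->] := CKP i.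
  exists (fun n => s (pickle (i, n))) => // n.
  by have := sp (pickle (i, n)); rewrite unpairK.
Qed.

End suslin.

Definition closed_network (T : topologicalType) (K : nat -> set T) :=
  (forall n, closed (K n)) /\
  forall U x, open U -> U x -> exists n, K n x /\ K n `<=` U.

Section suslin_measurable.
Variables (Omega : pointedType) (T : ptopologicalType) (H : set (set Omega)).
Variables (K : nat -> set T).
Hypothesis sH : sigma_algebra setT H.
Hypothesis netK : closed_network K.

(** The sets that are Suslin together with their complement form a
sigma-algebra, which contains the rectangles: an open set is a countable union
of closed sets of the network, and its complement is closed. *)
Lemma suslin_measurable (G : set (g_sigma_algebraType H * borel T)) :
  measurable G -> suslin H (G : set (Omega * T)).
Proof.
have H0 : H set0 by have [] := sH.
have HC A : H A -> H (~` A) by have [_ + _] := sH; rewrite -setTD; exact.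
have HT : H setT by rewrite -setC0; exact: HC.
have HE : measurable = H :> set (set (g_sigma_algebraType H)).
  exact: measurable_g_measurableTypeE.
pose S := [set G : set (Omega * T) | suslin H G /\ suslin H (~` G)].
have S0 : S set0.
  split.
    have := suslin_rect HT (@closed0 T); by rewrite setX0.
  have := suslin_rect HT (@closedT T); by rewrite setXTT setC0.
have SC B : S B -> S (~` B) by case=> ? ?; split => //; rewrite setCK.
have SU (F : (set (Omega * T))^nat) : (forall i, S (F i)) -> S (\bigcup_i F i).
  move=> SF; split; first by apply: suslin_bigcup => i; exact: (SF i).1.
  by rewrite setC_bigcup; apply: suslin_bigcap => i; exact: (SF i).2.
have sS : sigma_algebra setT S.
  by split=> // A /SC; rewrite setTD.
have SI A B : S A -> S B -> S (A `&` B).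
  move=> SA SB; rewrite -[_ `&` _]setCK; apply: (SC); rewrite setCI.
  rewrite (_ : _ `|` _ = \bigcup_i (if i is 0%N then ~` A else ~` B)).
    by apply: SU; case=> [|_]; exact: SC.
  apply/seteqP; split=> [p [?|?]|p [[|i] _]].
  - by exists 0%N.
  - by exists 1%N.
  - by left.
  - by right.
have SB (B : set T) : <<s @open T >> B -> S (setT `*` B).
  apply: (@smallest_sub _ (sigma_algebra setT) _ [set B | S (setT `*` B)]).
    split=> [|A /= /SC|F /= SF].
    - by rewrite /= setX0.
    - rewrite setTD; congr S; apply/seteqP; split=> p /=; last tauto.
      by move=> nA; split=> // Ap; exact: nA.
    - by rewrite setX_bigcupr; exact: SU.
  move=> U oU /=; split; last first.
    rewrite (_ : ~` _ = setT `*` ~` U).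
      by apply: suslin_rect => //; exact: open_closedC.
    apply/seteqP; split=> p /=; last tauto.
    by move=> nA; split=> // Ap; exact: nA.
  rewrite (_ : setT `*` U =
      \bigcup_n (setT `*` (if `[< K n `<=` U >] then K n else set0))); last first.
    rewrite -setX_bigcupr; congr (_ `*` _); apply/seteqP; split=> [x Ux|x [n _]].
      have [n [Knx KnU]] := netK.2 _ _ oU Ux.
      by exists n => //; rewrite asboolT.
    by case: asboolP => // + Knx; exact.
  apply: suslin_bigcup => n; apply: suslin_rect => //.
  by case: asboolP => // _; [exact: netK.1|exact: closed0].
have SA (A : set Omega) : H A -> S (A `*` setT).
  move=> HA; split; first by apply: suslin_rect => //; exact: closedT.
  rewrite (_ : ~` _ = ~` A `*` setT).
    by apply: suslin_rect; [exact: HC|exact: closedT].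
  apply/seteqP; split=> p /=; last tauto.
  by move=> nA; split=> // Ap; exact: nA.
rewrite measurable_prod_measurableType => mG.
suff [] : S G by [].
apply: smallest_sub mG => // _ [A mA [B mB <-]].
rewrite (_ : A `*` B = (A `*` setT) `&` (setT `*` B)).
  by apply: SI; [apply: SA; rewrite -HE|exact: SB].
by apply/seteqP; split=> p /=; tauto.
Qed.

End suslin_measurable.

(** * Measurable projection *)

Lemma decreasing_subset (T : Type) (F : (set T)^nat) :
  (forall n, F n.+1 `<=` F n) -> forall m n, (m <= n)%N -> F n `<=` F m.
Proof.
move=> decF m; elim=> [|n IH]; first by rewrite leqn0 => /eqP->.
rewrite leq_eqVlt => /predU1P[->//|]; rewrite ltnS => /IH.
by apply: subset_trans; exact: decF.
Qed.

Section projection.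
Context d (Omega : measurableType d) (R : realType) (P : probability Omega R).
Variable H : set (set Omega).
Hypothesis sH : sigma_algebra setT H.
Hypothesis mH : H `<=` (measurable : set (set Omega)).

(** The complement of the essentially largest member of [H] disjoint from [B]. *)
Lemma measurable_hull (B : set Omega) : exists h, [/\ H h, B `<=` h &
  forall A, H A -> B `<=` A -> P.-negligible (h `\` A)].
Proof.
have HC A : H A -> H (~` A) by have [_ + _] := sH; rewrite -setTD; exact.
have [||F AF|A [HA AB] Amax] := @exhaustion _ _ _ P [set A | H A /\ A `<=` ~` B].
- by move=> A [/mH].
- by exists set0; split; [have [] := sH|exact: sub0set].
- split; first by have [_ _] := sH; apply => n; exact: (AF n).1.
  by move=> w [n _]; exact: (AF n).2.
exists (~` A); split=> [|w Bw /AB|]; [exact: HC|exact|].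
move=> A' HA' BA'; rewrite setDE setIC -setDE; apply: Amax.
by split; [exact: HC|exact: subsetC].
Qed.

Variable T : topologicalType.

(** A common form of the two reasons for which closed sets have a common point:
for closed balls of radius tending to 0 in a complete metric space, and for
covers by compact sets. *)
Definition complete_covers (V : nat -> nat -> set T) :=
  [/\ forall n k, closed (V n k), forall n x, exists k, V n k x &
      forall (k : nat -> nat) (F : (set T)^nat),
        (forall n, closed (F n)) -> (forall n, F n !=set0) ->
        (forall n, F n.+1 `<=` F n) -> (forall n, F n `<=` V n (k n)) ->
        exists x, forall n, F n x].

(** For a finite sequence [s], let [D s] be the set of the [w] over which some
point of [G] is witnessed by a branch extending [s], and [h s] its hull in [H].
As [D s] is the union of the [D (rcons s a)], almost every [w] in [h s] belongs
to some [h (rcons s a)]; there are countably many [s], so outside one null set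
this holds for all of them. A point of [h [::]] outside that null set thus
follows a whole infinite branch, along which closedness of the tree and
completeness of the covers produce a point of [G] above it. Hence [h [::]] is
the projection of [G] up to a null set. *)
Lemma suslin_projection (V : nat -> nat -> set T) (G : set (Omega * T)) :
  complete_covers V -> suslin H G ->
  exists2 S, H S & {ae P, forall w, S w <-> exists x, G (w, x)}.
Proof.
move=> [clV covV cplV] [[C K] /= [clC HK clK GE]].
(* The second components of the branch choose the members of the covers. *)
pose branch w x (r : nat -> nat * nat) := [/\ C (fun n => (r n).1),
  forall n, (K n (r n).1).1 w /\ (K n (r n).1).2 x & forall n, V n (r n).2 x].
pose D (s : seq (nat * nat)) := [set w | exists x, exists2 r, branch w x r &
  mkseq r (size s) = s].
have [h hP] := choice (fun s => measurable_hull (D s)).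
have HU (A : seq (nat * nat) -> set Omega) s : (forall s, H (A s)) ->
    H [set w | exists a, A (rcons s a) w].
  move=> HA; rewrite (_ : [set _ | _] =
      \bigcup_n (if unpickle n is Some a then A (rcons s a) else set0)).
    by have [H0 _] := sH; apply=> n; case: unpickle.
  apply/seteqP; split=> [w [a Aw]|w [n _]].
    by exists (pickle a) => //; rewrite pickleK.
  by case: unpickle => // a Aw; exists a.
have aes : {ae P, forall w, forall s, h s w -> exists a, h (rcons s a) w}.
  apply: ae_forall_countable => s; have [Hh _ hmin] := hP s.
  have := hmin _ (HU h s (fun s => let: And3 H _ _ := hP s in H)).
  have DU : D s `<=` [set w | exists a, h (rcons s a) w].
    move=> w [x [r br rs]]; exists (r (size s)).
    have [_ + _] := hP (rcons s (r (size s))); apply; exists x, r => //.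
    by rewrite size_rcons mkseqS rs.
  move=> /(_ DU); apply: negligibleS => w /= nsw; split.
    by apply: contrapT => hw; exact: nsw.
  by move=> aw; exact: nsw.
have aeA : {ae P, forall w, forall sn : seq (nat * nat) * (nat * nat),
    D sn.1 `<=` (K sn.2.1 sn.2.2).1 -> h sn.1 w -> (K sn.2.1 sn.2.2).1 w}.
  apply: ae_forall_countable => -[s [n k]] /=; have [_ _ hmin] := hP s.
  have [DK|nDK] := pselect (D s `<=` (K n k).1); last exact: aeW.
  have := hmin _ (HK n k) DK; apply: negligibleS => w /= nsw; split.
    by apply: contrapT => hw; exact: nsw.
  by move=> aw; exact: nsw.
have ae0 : {ae P, forall w, forall s, h s w -> D s !=set0}.
  apply: ae_forall_countable => s; have [_ _ hmin] := hP s.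
  have [D0|nD0] := pselect (D s !=set0); first exact: aeW.
  have := hmin set0; have [H0 _ _] := sH => /(_ H0).
  have Ds0 : D s `<=` set0 by move=> w Dw; apply: nD0; exists w.
  move=> /(_ Ds0); apply: negligibleS => w /= nsw; split=> //.
  by apply: contrapT => hw; exact: nsw.
(* The set [h [::]] is the hull of the whole projection. *)
have [Hh0 Dh0 _] := hP [::].
exists (h [::]) => //; apply: filterS3 aes aeA ae0 => w ws wA w0; split.
- move=> hw; have /choice[next nextP] :
      forall s, exists a, h s w -> h (rcons s a) w.
    move=> s; have [/ws[a]|nh] := pselect (h s w); first by exists a.
    by exists (0, 0)%N.
  pose sq := fix sq n : seq (nat * nat) :=
    if n is n'.+1 then rcons (sq n') (next (sq n')) else [::].
  pose r n := next (sq n).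
  have sqE n : sq n = mkseq r n by elim: n => //= n IH; rewrite mkseqS -IH.
  have hr n : h (mkseq r n) w.
    by rewrite -sqE; elim: n => //= n; exact: nextP.
  have rE N r' : mkseq r' (size (mkseq r N)) = mkseq r N ->
      forall n, (n < N)%N -> r' n = r n.
    rewrite size_mkseq => /(congr1 (fun s => nth (0, 0)%N s)) rr n nN.
    by have := congr1 (@^~ n) rr; rewrite !nth_mkseq.
  have Cr : C (fun n => (r n).1).
    apply: clC => N; have [w' [x [r' [Cr' _ _] /rE r'E]]] := w0 _ (hr N).
    by exists (fun n => (r' n).1) => // n nN; rewrite r'E.
  have Ar n : (K n (r n).1).1 w.
    apply: (wA (mkseq r n.+1, (n, (r n).1))) => //= w' [x [r' [_ r'K _] /rE r'E]].
    by rewrite -r'E//; exact: (r'K n).1.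
  pose F N := \bigcap_(n in [set n | (n <= N)%N])
    ((K n (r n).1).2 `&` V n (r n).2).
  have [x Fx] : exists x, forall N, F N x.
    apply: (cplV (fun n => (r n).2)) => N.
    - by apply: closed_bigI => n _; exact: closedI.
    - have [w' [x [r' [_ r'K r'V] /rE r'E]]] := w0 _ (hr N.+1).
      exists x => n /= nN; rewrite -r'E//.
      by split; [exact: (r'K n).2|exact: r'V].
    - by move=> x Fx n /= nN; apply: Fx => /=; exact: leqW.
    - by move=> x /(_ N (leqnn N)) [].
  exists x; rewrite GE; exists (fun n => (r n).1) => // n; split=> //=.
  by have [] := Fx n n (leqnn n).
- move=> [x]; rewrite GE => -[s Cs sK]; apply: Dh0.
  have [k kV] := choice (fun n => covV n x).
  by exists x, (fun n => (s n, k n)).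
Qed.

End projection.

(** * Topology of the Banach space and of its dual *)

Section separable_banach.
Variables (R : realType) (E : completeNormedModType R) (x : nat -> E).
Hypothesis dx : forall (y : E) (e : R), 0 < e -> exists i, `|x i - y| < e.

Definition cball (y : E) (r : R) : set E := [set z | `|y - z| <= r].

Lemma closed_cball_norm y r : closed (cball y r).
Proof.
have /continuous_closedP : continuous (fun z : E => `|y - z|).
  by move=> z; apply: cvg_norm; apply: cvgB; [exact: cvg_cst|exact: cvg_id].
by move=> /(_ [set t | t <= r]); apply; exact: closed_le.
Qed.

(** The sets of the sequence generate a Cauchy filter, which converges. *)
Lemma banach_complete_covers :
  complete_covers (fun n k => cball (x k) n.+1%:R^-1).
Proof.
split=> [n k|n y|k F clF F0 decF FV]; first exact: closed_cball_norm.
  have [|i xi] := @dx y n.+1%:R^-1; first by rewrite invr_gt0.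
  by exists i; exact: ltW.
have decFm := decreasing_subset decF.
pose FF := [set A | exists n, F n `<=` A].
have FFF : ProperFilter FF.
  apply: Build_ProperFilter.
    by move=> [n Fn0]; have [y /Fn0] := F0 n.
  split.
  - by exists 0%N.
  - move=> A B [m mA] [n nB]; exists (maxn m n) => y Fy.
    split; [apply: mA|apply: nB]; move: Fy; apply: decFm.
      exact: leq_maxl.
    exact: leq_maxr.
  - by move=> A B AB [n nA]; exists n; exact: subset_trans AB.
have : cauchy FF.
  apply: cauchy_exP => e e0.
  have [n ne] := natSinv_lt e0.
  exists (x (k n)); exists n => y /FV /= xy; rewrite -ball_normE /=.
  exact: le_lt_trans ne.
move=> /cauchy_cvg/cvg_ex[y FFy]; exists y => n; apply: clF => B /FFy [m mB].
have [z Fz] := F0 (maxn m n); exists z; split.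
  by move: Fz; apply: decFm; rewrite leq_maxr.
by apply: mB; move: Fz; apply: decFm; rewrite leq_maxl.
Qed.

Lemma banach_closed_network : exists K, @closed_network E K.
Proof.
exists (fun k =>
  if unpickle k is Some (i, n) then cball (x i) n.+1%:R^-1 else set0).
split=> [k|U y oU Uy].
  by case: unpickle => [[i n]|]; [exact: closed_cball_norm|exact: closed0].
have /nbhs_ballP[e /= e0 eU] : nbhs y U by exact: open_nbhs_nbhs.
have e20 : 0 < e / 2 by rewrite divr_gt0.
have [n ne] := natSinv_lt e20.
have [|i xi] := @dx y n.+1%:R^-1; first by rewrite invr_gt0.
exists (pickle (i, n)); rewrite pickleK; split; first exact: ltW.
move=> z xz; apply: eU; rewrite -ball_normE /=.
rewrite -(subrKA (x i)) (le_lt_trans (ler_normD _ _))//.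
rewrite (splitr e) ltrD//; first by rewrite distrC (lt_trans xi).
exact: le_lt_trans ne.
Qed.

End separable_banach.

Section dual.
Variables (R : realType) (E : normedModType R).
Implicit Types (u v : dual E) (y : E) (m : nat).

Lemma cvg_initial (S : choiceType) (T : topologicalType) (f : S -> T)
    (F : set_system S) (s : S) :
  Filter F -> f @ F --> f s -> F --> (s : initial_topology f).
Proof.
move=> FF fF A /=; rewrite nbhsE => -[B [[D oD <-] Ds] BA].
by apply: filterS BA _; apply: fF; exact: open_nbhs_nbhs.
Qed.

(** The weak-star topology is the topology of pointwise convergence. *)
Lemma dual_cvg (F : set_system (dual E)) u : Filter F ->
  (forall y, (fun v : dual E => v y : R) @ F --> (u y : R)) -> F --> u.
Proof.
move=> FF Fu; apply: (@cvg_initial _ _ (@dual_eval R E)).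
have := @pointwise_cvgP E R^o (@dual_eval R E @ F) (@dual_eval R E u) _.
by move=> H; apply/H => y; exact: Fu.
Qed.

Lemma dual_eval_continuous y : continuous (fun u : dual E => u y : R).
Proof.
move=> u.
apply: (@continuous_comp _ _ _ (@dual_eval R E) (@proj E (fun=> R^o) y)).
  exact: initial_continuous.
exact: proj_continuous.
Qed.

Definition dual_ball m : set (dual E) :=
  [set u | forall y, `|u y| <= m%:R * `|y|].

Lemma dual_ball_ex u : exists m, dual_ball m u.
Proof.
have /linear_bounded_continuous/linear_boundedP[r [rR ru]] :=
  @dual_continuous _ _ u.
have [m rm] : exists m : nat, r < m%:R.
  exists (Num.trunc `|r|).+1.
  by rewrite (le_lt_trans (ler_norm _))// truncnS_gt.
by exists m; exact: ru.
Qed.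

Lemma closed_dual_ball m : closed (dual_ball m).
Proof.
rewrite (_ : dual_ball m =
    \bigcap_y ((fun u : dual E => `|u y : R|) @^-1` [set t | t <= m%:R * `|y|])).
  apply: closed_bigI => y _.
  have /continuous_closedP : continuous (fun u : dual E => `|u y : R|).
    move=> u.
    apply: (@continuous_comp (dual E) R R (fun u => u y) (@Num.norm _ R)).
      exact: dual_eval_continuous.
    exact: norm_continuous.
  by move=> /(_ [set t | t <= m%:R * `|y|]); apply; exact: closed_le.
by apply/seteqP; split=> u um y; [move=> _|]; exact: um.
Qed.

(** Weak-star compactness of balls, in sequential form: pick a point in each
set; along an ultrafilter finer than the Frechet filter their values at every
vector converge, and the limit functional is linear, bounded, and belongs to
all the closed sets. The covers do not depend on the level, since bounded balls
are already compact. *)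
Lemma dual_complete_covers : complete_covers (fun _ m => dual_ball m).
Proof.
split=> [_ m|_ u|k F clF F0 decF FV].
- exact: closed_dual_ball.
- exact: dual_ball_ex.
have [u uF] := choice F0.
have decFm := decreasing_subset decF.
have um n : dual_ball (k 0%N) (u n) by apply: FV; exact: decFm (leq0n n) _ (uF n).
have [U [UU NU]] := @ultraFilterLemma _ _ eventually_filter.
have PU : ProperFilter U by exact: ultra_proper.
have cvgU y : exists l : R, (fun n => u n y : R) @ U --> l.
  have [|l [_ ul]] := @segment_compact R (- ((k 0%N)%:R * `|y|))
      ((k 0%N)%:R * `|y|) ((fun n => u n y : R) @ U) _.
    apply: (@filterE _ U) => n /=; have := um n y.
    by rewrite in_itv/= ler_norml.
  exists l => B lB.
  have [//|UB] := in_ultra_setVsetC ((fun n => u n y : R) @^-1` B) UU.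
  by have [z []] := ul (~` B) B UB lB.
have [l ul] := choice cvgU.
have l_lin : linear_for *%R l.
  move=> t y z; apply: (cvg_unique _ (ul _)); first exact: Rhausdorff.
  have -> : (fun n => u n (t *: y + z) : R) = (fun n => t * u n y + u n z).
    by apply/funext => n; rewrite linearP.
  by apply: cvgD (ul z); apply: cvgMl_tmp; exact: ul.
have lm y : `|l y| <= (k 0%N)%:R * `|y|.
  apply: (closed_cvg [set t : R | t <= (k 0%N)%:R * `|y|] _ _ _
    (@cvg_norm _ R _ U _ _ _ (ul y))); first exact: closed_le.
  by apply: (@filterE _ U) => n; exact: um.
pose L := GRing.isLinear.Build R E R^o *:%R l l_lin.
pose ll : {linear E -> R^o} := HB.pack l L.
have lc : continuous ll.
  apply/linear_bounded_continuous/linear_boundedP.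
  exists (k 0%N)%:R; split=> [|r /ltW cr y]; first exact: num_real.
  by apply: le_trans (lm y) _; rewrite ler_wpM2r.
exists (Dual lc) => n.
have uU : u @ U --> Dual lc by apply: dual_cvg => y; exact: ul.
apply: (closed_cvg _ (clF n)) uU.
apply: NU; exists n => // n' /= nn'; exact: decFm nn' _ (uF n').
Qed.

End dual.

Section dual_network.
Variables (R : realType) (E : normedModType R) (x : nat -> E).
Hypothesis dx : forall (y : E) (e : R), 0 < e -> exists i, `|x i - y| < e.

(** The bound on the norm is what makes countably many cylinders enough: on a
ball of the dual, values at the dense sequence control the values at all
vectors, uniformly. *)
Definition rat_cylinder m (s : seq (nat * (rat * rat))) : set (dual E) :=
  dual_ball m `&` [set v | forall t, t \in s ->
    ratr t.2.1 <= (v (x t.1) : R) /\ (v (x t.1) : R) <= ratr t.2.2].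

Lemma closed_rat_cylinder m s : closed (rat_cylinder m s).
Proof.
apply: closedI; first exact: closed_dual_ball.
rewrite [X in closed X](_ : _ = \bigcap_(t in [set` s])
    ((fun v : dual E => v (x t.1) : R) @^-1` [set` `[ratr t.2.1, ratr t.2.2]])).
  apply: closed_bigI => t _.
  have /continuous_closedP := @dual_eval_continuous R E (x t.1).
  by move=> /(_ [set` `[ratr t.2.1, ratr t.2.2]]); apply; exact: itv_closed.
apply/seteqP; split=> v sv t /= ts.
  by have [? ?] := sv t ts; rewrite in_itv/=; apply/andP.
by have := sv t ts; rewrite /= in_itv/= => /andP[].
Qed.

Lemma dual_dist_le m (u v : dual E) y z : dual_ball m u -> dual_ball m v ->
  `|(u y : R) - v y| <= `|(u z : R) - v z| + 2 * (m%:R * `|z - y|).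
Proof.
move=> um vm; have uy := um (z - y); have vy := vm (z - y).
move: uy vy; rewrite !linearB /= => uy vy.
have -> : (u y : R) - v y = (u z - v z) - ((u z - u y) - (v z - v y)) by lra.
apply: le_trans (ler_normB _ _) _; rewrite lerD2l.
by apply: le_trans (ler_normB _ _) _; rewrite mulrDl mul1r lerD.
Qed.

(** Fix a ball containing [u]. The rational cylinders of that ball containing
[u] generate a filter along which the values at every vector converge to those
of [u]; so the filter converges to [u] and contains every neighborhood. *)
Lemma rat_cylinder_nbhs (u : dual E) (U : set (dual E)) : open U -> U u ->
  exists c : nat * seq (nat * (rat * rat)),
    rat_cylinder c.1 c.2 u /\ rat_cylinder c.1 c.2 `<=` U.
Proof.
move=> oU Uu; have [m um] := dual_ball_ex u.
pose F : set_system (dual E) :=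
  [set A | exists s, rat_cylinder m s u /\ rat_cylinder m s `<=` A].
have FF : Filter F.
  split.
  - by exists [::]; split=> //; split.
  - move=> A B [s [us sA]] [s' [us' sB]]; exists (s ++ s'); split.
      split=> // t; rewrite mem_cat => /orP[]; first exact: us.2.
      exact: us'.2.
    move=> v [vm vs]; split; [apply: sA|apply: sB]; split=> // t ts;
      by apply: vs; rewrite mem_cat ts ?orbT.
  - by move=> A B AB [s [us sA]]; exists s; split=> //; exact: subset_trans AB.
suff Fu : F --> u.
  by have [s us] := Fu U (open_nbhs_nbhs (conj oU Uu)); exists (m, s).
apply: dual_cvg => y; apply/cvgrPdist_lt => e e0.
(* Adding 1 keeps the divisor positive when the ball has radius 0. *)
pose M : R := m%:R + 1.
have M0 : 0 < M by rewrite ltr_wpDl.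
have [|i xi] := @dx y (e / (4 * M)); first by rewrite divr_gt0// mulr_gt0.
have e20 : 0 < e / 4 by rewrite divr_gt0.
have [|a] := @rat_in_itvoo R (u (x i) - e / 4) (u (x i)); first by rewrite gtrBl.
have [|b] := @rat_in_itvoo R (u (x i)) (u (x i) + e / 4); first by rewrite ltrDl.
rewrite !in_itv/= => /andP[ub bu] /andP[au ua].
exists [:: (i, (a, b))]; split.
  by split=> // t; rewrite inE => /eqP -> /=; rewrite !ltW.
move=> v [vm /(_ (i, (a, b)))]; rewrite inE eqxx => /(_ isT) [/= av vb].
apply: le_lt_trans (dual_dist_le y (x i) um vm) _.
have : `|(u (x i) : R) - v (x i)| < e / 4.
  by rewrite ltr_norml; apply/andP; split; lra.
have : m%:R * `|x i - y| <= e / 4.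
  have : M * `|x i - y| <= e / 4.
    move: xi; rewrite ltr_pdivlMr; last by rewrite mulr_gt0.
    by rewrite mulrCA => xi; nra.
  by apply: le_trans; rewrite ler_wpM2r// lerDl.
by lra.
Qed.

Lemma dual_closed_network : exists K, @closed_network (dual E) K.
Proof.
exists (fun k =>
  if unpickle k is Some (m, s) then rat_cylinder m s else set0).
split=> [k|U u oU Uu].
  by case: unpickle => [[m s]|]; [exact: closed_rat_cylinder|exact: closed0].
have [[m s] us] := rat_cylinder_nbhs oU Uu.
by exists (pickle (m, s)); rewrite pickleK.
Qed.

End dual_network.

(** * Random sets, their polars and the core *)

Section random_sets_lemmas.
Context d (Omega : measurableType d) (H : set (set Omega)).
Variable T : ptopologicalType.
Hypothesis sH : sigma_algebra setT H.

Lemma measurable_open_borel (U : set T) :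
  open U -> measurable (U : set (borel T)).
Proof. exact: sub_sigma_algebra. Qed.

Lemma measurable_closed_borel (F : set T) :
  closed F -> measurable (F : set (borel T)).
Proof.
move=> /closed_openC/measurable_open_borel/measurableC; by rewrite setCK.
Qed.

Lemma random_set_cst (B : set T) :
  measurable (B : set (borel T)) -> random_set H (fun _ => B).
Proof.
move=> mB; rewrite /random_set (_ : [set p | _] = setT `*` B).
  exact: measurableX.
by apply/seteqP; split=> p /=; tauto.
Qed.

Lemma random_set_when (S : set Omega) :
  H S -> random_set H (fun w => [set _ : T | S w]).
Proof.
move=> HS; rewrite /random_set (_ : [set p | _] = S `*` setT).
  by apply: measurableX => //; rewrite measurable_g_measurableTypeE.
by apply/seteqP; split=> p /=; tauto.
Qed.

Lemma random_set_imply (S : set Omega) (B : set T) :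
  H S -> measurable (B : set (borel T)) ->
  random_set H (fun w => [set t | S w -> B t]).
Proof.
move=> /random_set_when mS /random_set_cst mB.
rewrite /random_set (_ : [set p | _] =
    ~` [set p | S p.1] `|` [set p | B p.2]).
  by apply: measurableU => //; exact: measurableC.
apply/seteqP; split=> p /=; last tauto.
by move=> SB; have [Sp|] := pselect (S p.1); [right; exact: SB|left].
Qed.

Lemma random_setI (D D' : Omega -> set T) : random_set H D -> random_set H D' ->
  random_set H (fun w => D w `&` D' w).
Proof. exact: measurableI. Qed.

Lemma random_set_bigcup (D : nat -> Omega -> set T) :
  (forall n, random_set H (D n)) -> random_set H (fun w => \bigcup_n D n w).
Proof.
move=> mD; rewrite /random_set (_ : [set p | _] =
    \bigcup_n [set p | D n p.1 p.2]); first exact: bigcupT_measurable.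
by [].
Qed.

Lemma random_set_forall (I : countType) (D : I -> Omega -> set T) :
  (forall i, random_set H (D i)) ->
  random_set H (fun w => [set t | forall i, D i w t]).
Proof.
move=> mD; rewrite /random_set (_ : [set p | _] = \bigcap_n
    (if unpickle n is Some i then [set p | D i p.1 p.2] else setT)).
  apply: bigcap_measurable => [|n _]; first by exists 0%N.
  by case: unpickle => [i|]; [exact: mD|exact: measurableT].
apply/seteqP; split=> p Dp => [n _|i].
  by case: unpickle => // i; exact: Dp.
by have := Dp (pickle i) Logic.I; rewrite pickleK.
Qed.

End random_sets_lemmas.

Section conditional.
Context d (Omega : measurableType d) (R : realType) (P : probability Omega R).
Variable H : set (set Omega).
Hypothesis sH : sigma_algebra setT H.
Hypothesis mH : H `<=` (measurable : set (set Omega)).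

(** Meeting [B] is the projection of the graph of [D] intersected with [B]. *)
Lemma random_set_hit (T : ptopologicalType) (V : nat -> nat -> set T)
    (K : nat -> set T) (D : Omega -> set T) (B : set T) :
  complete_covers V -> closed_network K ->
  random_set H D -> measurable (B : set (borel T)) ->
  exists2 S, H S & {ae P, forall w, S w <-> (D w `&` B) !=set0}.
Proof.
move=> covV netK rD mB.
have mDB : random_set H (fun w => D w `&` B).
  by apply: random_setI => //; exact: random_set_cst.
exact: (suslin_projection P sH mH covV (suslin_measurable sH netK mDB)).
Qed.

Variables (E : completeNormedModType R) (x : nat -> E).
Hypothesis dx : forall (y : E) (e : R), 0 < e -> exists i, `|x i - y| < e.

Lemma dual_hit (D : Omega -> set (dual E)) (B : set (dual E)) :
  random_set H D -> measurable (B : set (borel (dual E))) ->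
  exists2 S, H S & {ae P, forall w, S w <-> (D w `&` B) !=set0}.
Proof.
have [K netK] := dual_closed_network dx.
exact: (random_set_hit (@dual_complete_covers R E) netK).
Qed.

Lemma banach_hit (D : Omega -> set E) (B : set E) :
  random_set H D -> measurable (B : set (borel E)) ->
  exists2 S, H S & {ae P, forall w, S w <-> (D w `&` B) !=set0}.
Proof.
have [K netK] := banach_closed_network dx.
exact: (random_set_hit (banach_complete_covers dx) netK).
Qed.

(** The bound on the norm lets a slab based at the dense sequence control the
value of its functionals at a nearby vector, since the functionals of a ball of
the dual share a Lipschitz constant. *)
Definition slab (j : nat * nat * rat) : set (dual E) :=
  dual_ball j.1.1 `&` [set u | ratr j.2 < (u (x j.1.2) : R)].

Lemma measurable_slab j : measurable (slab j : set (borel (dual E))).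
Proof.
apply: measurableI.
  by apply: measurable_closed_borel; exact: closed_dual_ball.
apply: measurable_open_borel.
have /continuousP := @dual_eval_continuous R E (x j.1.2).
by move=> /(_ [set t | ratr j.2 < t]); apply; exact: open_gt.
Qed.

Lemma dual_ball_lip m (u : dual E) y z :
  dual_ball m u -> (u y : R) <= u z + m%:R * `|y - z|.
Proof.
move=> um; have := um (y - z); rewrite linearB /=.
by move=> /(le_trans (ler_norm _)); rewrite lerBlDl.
Qed.

Lemma approx_point m (y : E) (e : R) : 0 < e ->
  exists i, m%:R * `|x i - y| < e.
Proof.
move=> e0; have [|i xi] := @dx y (e / (m%:R + 1)).
  by rewrite divr_gt0// ltr_wpDl.
exists i; have m0 : 0 <= m%:R :> R by [].
move: xi; rewrite ltr_pdivlMr; last by rewrite ltr_wpDl.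
have := normr_ge0 (x i - y); nra.
Qed.

Lemma slab_near m (u : dual E) y (e : R) : 0 < e -> dual_ball m u ->
  exists j, [/\ slab j u, j.1.1 = m, m%:R * `|x j.1.2 - y| < e &
    (u y : R) <= ratr j.2 + e].
Proof.
move=> e0 um; have e20 : 0 < e / 2 by rewrite divr_gt0.
have [i xi] := approx_point m y e20.
have [|q] := @rat_in_itvoo R (u (x i) - e / 2) (u (x i)); first by rewrite gtrBl.
rewrite in_itv/= => /andP[uq qu].
exists (m, i, q); split=> //=; first by lra.
by have := dual_ball_lip y (x i) um; rewrite distrC => ?; lra.
Qed.

(** [S j] is the essentially largest event on which some measurable random
subset of the polar meets the slab [j], and the core consists of the [u] that
belong to slabs [j] only on [S j]. A measurable random subset [D] of the polar
lies in it, since the event that [D] meets the slab is one of those exhausted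
by [S j]. Conversely, let [u] be in this set and [y] in [Y w]: near the value
of [u] at [y] there is a slab containing [u], hence meeting the polar, and a
functional of the polar in that slab is at most 1 at [y]. *)
Lemma cond_core_polar_exists (Y : Omega -> set E) :
  exists C, is_cond_core P H (fun w => polar (Y w)) C.
Proof.
pose Z w := polar (Y w).
pose hits j S (D : Omega -> set (dual E)) :=
  [/\ random_set H D, as_subset P D Z &
      {ae P, forall w, S w -> (D w `&` slab j) !=set0}].
pose AA j := [set S | H S /\ exists D, hits j S D].
have /choice[S SP] j : exists S, AA j S /\
    forall S', AA j S' -> P.-negligible (S' `\` S).
  have [||F AF|S AS Smax] := @exhaustion _ _ _ P (AA j).
  - by move=> S [/mH].
  - exists set0; split; first by have [] := sH.
    exists (fun=> set0); split.
    + by apply: random_set_cst; exact: measurable0.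
    + by apply: aeW => w.
    + by apply: aeW => w.
  - have /choice[D DP] n : exists D, hits j (F n) D by have [_] := AF n.
    split; first by have [_ _] := sH; apply => n; have [] := AF n.
    exists (fun w => \bigcup_n D n w); split.
    + by apply: random_set_bigcup => n; have [] := DP n.
    + have : {ae P, forall w, forall n, D n w `<=` Z w}.
        by apply: ae_foralln => n; have [] := DP n.
      by apply: filterS => w DZ u [n _]; exact: DZ.
    + have : {ae P, forall w, forall n, F n w -> (D n w `&` slab j) !=set0}.
        by apply: ae_foralln => n; have [] := DP n.
      apply: filterS => w FD [n _ /FD[u [Du su]]]; exists u; split=> //.
      by exists n.
  - by exists S.
have SC (D : Omega -> set (dual E)) : random_set H D -> as_subset P D Z ->
    {ae P, forall w, forall j, (D w `&` slab j) !=set0 -> S j w}.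
  move=> rD DZ; apply: ae_forall_countable => j.
  have [S' HS' S'E] := dual_hit rD (measurable_slab j).
  have : P.-negligible (S' `\` S j).
    apply: (SP j).2; split=> //; exists D; split=> //.
    by apply: filterS S'E => w [].
  move=> nS'; have : {ae P, forall w, S' w -> S j w}.
    apply: negligibleS nS' => w /= nS'S; split.
      by apply: contrapT => S'w; exact: nS'S.
    by move=> Sw; exact: nS'S.
  by apply: filterS2 S'E => w S'w imp /S'w.
exists (fun w => [set u | forall j, slab j u -> S j w]); split.
- apply: random_set_forall => j.
  (* Contraposition puts the condition on [w] first. *)
  rewrite (_ : (fun _ => _) =
      fun w => [set u | (~` S j) w -> (~` slab j) u]).
    apply: random_set_imply => //.
      by have [_ + _] := sH; rewrite -setTD; apply; have [[]] := SP j.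
    by apply: measurableC; exact: measurable_slab.
  apply/funext => w; apply/seteqP; split=> u /= sS.
    by move=> nS /sS.
  by move=> su; apply: contrapT => /sS.
- have /choice[D DP] j : exists D, hits j (S j) D by have [[]] := SP j.
  have aeD : {ae P, forall w, forall j, D j w `<=` Z w}.
    by apply: ae_forall_countable => j; have [] := DP j.
  have aeS : {ae P, forall w, forall j, S j w -> (D j w `&` slab j) !=set0}.
    by apply: ae_forall_countable => j; have [] := DP j.
  apply: filterS2 aeD aeS => w DZ SD u uC y Yy.
  apply/ler_addgt0Pr => e e0; have e20 : 0 < e / 2 by rewrite divr_gt0.
  have [m um] := dual_ball_ex u.
  have [j [su jm xj uj]] := slab_near y e20 um.
  have [v [Dv [vm qv]]] := SD j (uC j su).
  have vy : (v y : R) <= 1 by exact: (DZ j v Dv).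
  move: vm; rewrite jm => /(dual_ball_lip (x j.1.2) y) vl.
  move: qv; rewrite /= => qv; lra.
- move=> D rD DZ; apply: filterS (SC D rD DZ) => w DS u Du j su.
  by apply: DS; exists u.
Qed.

(** A functional [u] of norm at most [m] lies in the polar of [M w] exactly when
it is at most [1 + m r] at the center of every ball of radius [r] that meets
[M w]; centers in the dense sequence and radii [1 / (n + 1)] suffice. *)
Lemma random_polar (M : Omega -> set E) : random_set H M ->
  exists2 D, random_set H D & {ae P, forall w, D w = polar (M w)}.
Proof.
move=> rM.
have /choice[S SP] (k : nat * nat) : exists S, H S /\
      {ae P, forall w,
        S w <-> (M w `&` cball (x k.1) k.2.+1%:R^-1) !=set0}.
  have [|S HS SE] := @banach_hit M (cball (x k.1) k.2.+1%:R^-1) rM.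
    by apply: measurable_closed_borel; exact: closed_cball_norm.
  by exists S.
exists (fun w => [set u | forall j : nat * (nat * nat),
  S j.2 w ->
  (dual_ball j.1 u -> (u (x j.2.1) : R) <= 1 + j.1%:R / j.2.2.+1%:R)]).
  apply: random_set_forall => j; apply: random_set_imply => //.
    by have [] := SP j.2.
  rewrite [X in measurable X](_ : _ = ~` dual_ball j.1 `|`
      [set u : dual E | (u (x j.2.1) : R) <= 1 + j.1%:R / j.2.2.+1%:R]).
    apply: measurableU.
      apply: measurableC; apply: measurable_closed_borel.
      exact: closed_dual_ball.
    apply: measurable_closed_borel.
    have /continuous_closedP := @dual_eval_continuous R E (x j.2.1).
    move=> /(_ [set t | t <= 1 + j.1%:R / j.2.2.+1%:R]); apply.
    exact: closed_le.
  apply/seteqP; split=> u /=; last tauto.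
  move=> uj; have [um|] := pselect (dual_ball j.1 u); last by left.
  by right; exact: uj.
have : {ae P, forall w, forall k,
    S k w <-> (M w `&` cball (x k.1) k.2.+1%:R^-1) !=set0}.
  by apply: ae_forall_countable => k; have [] := SP k.
apply: filterS => w Sw; apply/seteqP; split=> u /=.
- move=> uS y My; apply/ler_addgt0Pr => e e0.
  have [m um] := dual_ball_ex u.
  have e20 : 0 < e / (2 * (m%:R + 1)) by rewrite divr_gt0// mulr_gt0// ltr_wpDl.
  have [n ne] := natSinv_lt e20.
  have [|i xi] := @dx y n.+1%:R^-1; first by rewrite invr_gt0.
  have Siw : S (i, n) w by apply/Sw; exists y; split=> //=; exact: ltW.
  have := uS (m, (i, n)) Siw um => /= uxi.
  have := dual_ball_lip y (x i) um; rewrite distrC => uy.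
  move: ne; rewrite ltr_pdivlMr; last by rewrite mulr_gt0// ltr_wpDl.
  have m0 : 0 <= m%:R :> R by [].
  have n0 : 0 < n.+1%:R^-1 :> R by rewrite invr_gt0.
  move: uxi xi uy; set r := n.+1%:R^-1 in n0 *; set a := `|_| => uxi xi uy ne.
  have : m%:R * a <= m%:R * r by rewrite ler_wpM2l// ltW.
  by nra.
- move=> uM [m [i n]] /= /Sw [y [My /= xy]] um.
  apply: le_trans (dual_ball_lip (x i) y um) _.
  by rewrite lerD//; [exact: uM|rewrite ler_wpM2l].
Qed.

(** A functional [u] of norm at most [m] satisfies [u y <= 1] exactly when
[u z <= 1 + m |z - y|] for every [z]; let [z] run through the dense sequence
and bound [u z] from below by rationals. *)
Lemma random_predual_polar (C : Omega -> set (dual E)) : random_set H C ->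
  exists2 M, random_set H M & {ae P, forall w, M w = predual_polar (C w)}.
Proof.
move=> rC.
have /choice[S SP] j : exists S, H S /\
    {ae P, forall w, S w <-> (C w `&` slab j) !=set0}.
  by have [S HS SE] := dual_hit rC (measurable_slab j); exists S.
exists (fun w => [set y | forall j,
  S j w -> ratr j.2 <= 1 + j.1.1%:R * `|x j.1.2 - y|]).
  apply: random_set_forall => j; apply: random_set_imply => //.
    by have [] := SP j.
  apply: measurable_closed_borel.
  have /continuous_closedP :
      continuous (fun y : E => 1 + j.1.1%:R * `|x j.1.2 - y|).
    move=> y; apply: cvgD; first exact: cvg_cst.
    apply: cvgMl_tmp; apply: cvg_norm.
    by apply: cvgB; [exact: cvg_cst|exact: cvg_id].
  by move=> /(_ [set t | ratr j.2 <= t]); apply; exact: closed_ge.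
have : {ae P, forall w, forall j, S j w <-> (C w `&` slab j) !=set0}.
  by apply: ae_forall_countable => j; have [] := SP j.
apply: filterS => w Sw; apply/seteqP; split=> y /=.
- move=> yS u Cu; apply/ler_addgt0Pr => e e0.
  have [m um] := dual_ball_ex u; have e20 : 0 < e / 2 by rewrite divr_gt0.
  have [j [su jm xj uj]] := slab_near y e20 um.
  have Sj : S j w by apply/Sw; exists u.
  by have := yS j Sj; rewrite jm; lra.
- move=> yC j /Sw [u [Cu [um /= qu]]].
  apply: le_trans (ltW qu) _; apply: le_trans (dual_ball_lip _ y um) _.
  by rewrite lerD2r; exact: yC.
Qed.

End conditional.

(** * Duality of hull and core *)

Section polar_sets.
Variables (R : realType) (E : normedModType R).

Lemma closed_predual_polar (B : set (dual E)) : closed (predual_polar B).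
Proof.
rewrite (_ : predual_polar B =
    \bigcap_(u in B) ((fun y => u y : R) @^-1` [set t | t <= 1])).
  apply: closed_bigI => u _.
  have /continuous_closedP := @dual_continuous _ _ u.
  by move=> /(_ [set t : R | t <= 1]); apply; exact: closed_le.
by apply/seteqP; split.
Qed.

Lemma convex_predual_polar (B : set (dual E)) : convex_set (predual_polar B).
Proof.
move=> y z l; rewrite !inE => yB zB u Bu.
have l0 : 0 <= l%:num by []. have l1 : l%:num <= 1 by [].
rewrite (_ : u _ = l%:num * u y + (1 - l%:num) * u z :> R).
  by have := yB u Bu; have := zB u Bu; rewrite /= => *; nra.
by rewrite linearD !linearZ.
Qed.

Lemma sub_predual_polar (A : set E) : A `<=` predual_polar (polar A).
Proof. by move=> y Ay u uA; exact: uA. Qed.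

Lemma predual_polarS (B B' : set (dual E)) :
  B `<=` B' -> predual_polar B' `<=` predual_polar B.
Proof. by move=> BB' y yB' u /BB'; exact: yB'. Qed.

Lemma polarS (A A' : set E) : A `<=` A' -> polar A' `<=` polar A.
Proof. by move=> AA' u uA' y /AA'; exact: uA'. Qed.

End polar_sets.

Lemma separable_dense_seq (R : realType) (E : normedModType R) : separable E ->
  exists x : nat -> E, forall (y : E) (e : R), 0 < e -> exists i, `|x i - y| < e.
Proof.
move=> [D cD dD].
have DB (y : E) (e : R) : 0 < e -> exists z, D z /\ `|z - y| < e.
  move=> e0; have [||z [yz Dz]] := dD (ball y e).
  - by exists y; exact: ballxx.
  - exact: ball_open.
  exists z; split=> //.
  by move: yz; rewrite -ball_normE /= distrC.
have [z0 [Dz0 _]] := DB 0 1 ltr01.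
have /pfcard_geP[D0|[f]] := cD; first by move: Dz0; rewrite D0.
exists f => y e e0; have [z [Dz zy]] := DB y e e0.
have [n _ fn] := 'surj_f Dz; by exists n; rewrite fn.
Qed.

Section hull_core_duality.
Context d (Omega : measurableType d) (R : realType) (P : probability Omega R).
Variables (H : set (set Omega)) (E : completeNormedModType R).
Hypothesis sH : sigma_algebra setT H.
Hypothesis mH : H `<=` (measurable : set (set Omega)).
Hypothesis sepE : separable E.

(** The polar of a competitor [Y'] is a random set contained in the polar of
[Y], hence in the core; taking polars again and applying the bipolar theorem
to [Y'], which contains 0, shows that [Y'] contains the polar of the core. *)
Lemma cond_convex_hull_of_core (Y : Omega -> set E) (C : Omega -> set (dual E)) :
  {ae P, forall w, Y w 0} -> is_cond_core P H (fun w => polar (Y w)) C ->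
  exists2 M, is_cond_convex_hull P H Y M &
    {ae P, forall w, M w = predual_polar (C w)}.
Proof.
move=> Y0 [rC CY Cmax]; have [x dx] := separable_dense_seq sepE.
have [M rM ME] := random_predual_polar P sH mH dx rC.
exists M => //; split.
- split=> //; apply: filterS ME => w ->.
    exact: closed_predual_polar.
  exact: convex_predual_polar.
- apply: filterS2 CY ME => w CYw -> y Yy.
  by apply: predual_polarS CYw _ _; exact: sub_predual_polar.
- move=> Y' [rY' clY' cY'] YY'; have [D rD DE] := random_polar P sH mH dx rY'.
  have DC : as_subset P D C.
    apply: Cmax => //; apply: filterS2 YY' DE => w YY'w ->; exact: polarS.
  have MD : {ae P, forall w, M w `<=` predual_polar (D w)}.
    by apply: filterS2 DC ME => w DCw ->; exact: predual_polarS.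
  have DY' : {ae P, forall w, predual_polar (D w) = Y' w}.
    have Y'0 : {ae P, forall w, Y' w 0} by apply: filterS2 YY' Y0 => w; exact.
    have bip : {ae P, forall w, predual_polar (polar (Y' w)) = Y' w}.
      by apply: filterS3 clY' cY' Y'0 => w; exact: bipolar.
    by apply: filterS2 DE bip => w ->.
  by apply: filterS2 MD DY' => w MDw <-.
Qed.

Lemma cond_core_unique (T : ptopologicalType) (Z C C' : Omega -> set T) :
  is_cond_core P H Z C -> is_cond_core P H Z C' -> {ae P, forall w, C w = C' w}.
Proof.
move=> [rC CZ Cmax] [rC' C'Z C'max].
apply: filterS2 (C'max _ rC CZ) (Cmax _ rC' C'Z) => w CC' C'C.
by apply/seteqP.
Qed.

Lemma cond_convex_hull_unique (X M M' : Omega -> set E) :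
  is_cond_convex_hull P H X M -> is_cond_convex_hull P H X M' ->
  {ae P, forall w, M w = M' w}.
Proof.
move=> [rM XM Mmin] [rM' XM' M'min].
apply: filterS2 (Mmin _ rM' XM') (M'min _ rM XM) => w MM' M'M.
by apply/seteqP.
Qed.

End hull_core_duality.

Theorem proposition5p5 (R : realType) (E : completeNormedModType R)
    (d : measure_display) (Omega : measurableType d) (P : probability Omega R)
    (H : set (set Omega)) (X : Omega -> set E) :
  separable E ->
  measure_is_complete P ->
  sigma_algebra [set: Omega] H ->
  H `<=` (measurable : set (set Omega)) ->
  random_set (measurable : set (set Omega)) X ->
  L0 P H X !=set0 ->
  forall gamma : Omega -> E, L0 P H X gamma ->
    [/\ exists M : Omega -> set E,
          is_cond_convex_hull P H (translate X gamma) M,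
        exists C : Omega -> set (dual E),
          is_cond_core P H (fun w => polar (translate X gamma w)) C &
        forall (M : Omega -> set E) (C : Omega -> set (dual E)),
          is_cond_convex_hull P H (translate X gamma) M ->
          is_cond_core P H (fun w => polar (translate X gamma w)) C ->
          {ae P, forall w, M w = predual_polar (C w)}].
Proof.
move=> sepE _ sH mH _ _ gamma [_ gammaX].
have Y0 : {ae P, forall w, translate X gamma w 0}.
  by apply: filterS gammaX => w Xw; exists (gamma w) => //; exact: subrr.
have [x dx] := separable_dense_seq sepE.
have [C coreC] := cond_core_polar_exists P sH mH dx (translate X gamma).
have [M hullM ME] := cond_convex_hull_of_core sH mH sepE Y0 coreC.
split; [by exists M|by exists C|move=> M' C' hullM' coreC'].
have MM' := cond_convex_hull_unique hullM hullM'.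
have CC' := cond_core_unique coreC coreC'.
by apply: filterS3 MM' CC' ME => w <- <-.
Qed.
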